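(* Let $k\geq 0$ be an integer and let $G$ be a $k$-gap-planar graph. Then for every integer $r\geq 0$, $$\nabla_r(G)\leq 18(k+1)(r+1).$$
   Context: All graphs are simple, finite and undirected. A drawing of a graph $G$ in the plane represents each vertex by a distinct point and each edge $vw$ by a non-self-intersecting curve between the points of $v$ and $w$, such that no three edges cross at a single point. A drawing is $k$-gap-planar if every crossing can be charged to one of the two edges involved so that at most $k$ crossings are charged to each edge; a graph is $k$-gap-planar if it has a $k$-gap-planar drawing in the plane. The density of a graph $G$ is $|E(G)|/|V(G)|$ if $V(G)\neq\emptyset$, and $0$ otherwise. A model of a graph $H$ in $G$ is a map $\mu$ assigning to each $v\in V(H)$ a non-empty connected subgraph $\mu(v)$ of $G$, with $\mu(v)\cap\mu(w)=\emptyset$ for distinct $v,w$, and such that for every edge $vw\in E(H)$ some edge of $G$ joins $\mu(v)$ and $\mu(w)$. The model is $r$-shallow if each $\mu(v)$ has radius at most $r$; $H$ is an $r$-shallow minor of $G$ if such a model exists. $\nabla_r(G)$ denotes the maximum density of an $r$-shallow minor of $G$. *)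

(* Defs.v *)
From Stdlib Require Import Reals List.
From mathcomp Require Import all_boot all_algebra.
Set Implicit Arguments.
Unset Strict Implicit.
Unset Printing Implicit Defensive.

Definition simple_graph (T : finType) (g : rel T) : Prop :=
  symmetric g /\ irreflexive g.

Definition edge_set (T : finType) (g : rel T) : {set {set T}} :=
  [set [set p.1; p.2] | p in [set q : T * T | g q.1 q.2]].

Definition density (T : finType) (g : rel T) : rat :=
  if #|T| == 0%N then 0%R
  else (#|edge_set g|%:R / #|T|%:R)%R.

Definition reach_within (T : finType) (g : rel T) (A : {set T}) (r : nat)
  (c x : T) : Prop :=
  exists p : seq T, [/\ (size p <= r)%N, path g c p, last c p = x &
                        all (fun y => y \in A) (c :: p)].

(* The (induced) subgraph on A has radius at most r (A nonempty): some centre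
   c in A reaches every vertex of A within distance r inside G[A].
   (This also gives connectivity.) *)
Definition radius_le (T : finType) (g : rel T) (A : {set T}) (r : nat) : Prop :=
  exists2 c, c \in A & forall x, x \in A -> reach_within g A r c x.

Definition shallow_model (S T : finType) (h : rel S) (g : rel T) (r : nat)
  (mu : S -> {set T}) : Prop :=
  [/\ forall v, mu v != set0,
      forall v w, v != w -> [disjoint mu v & mu w],
      forall v, radius_le g (mu v) r &
      forall v w, h v w -> exists2 x, x \in mu v & exists2 y, y \in mu w & g x y].

Definition shallow_minor (S T : finType) (h : rel S) (g : rel T) (r : nat) : Prop :=
  exists mu : S -> {set T}, shallow_model h g r mu.

Section Drawings.
Local Open Scope R_scope.
Variable T : finType.
Variable g : rel T.

Definition in01 (t : R) : Prop := 0 <= t <= 1.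

Definition pdist (p q : R * R) : R := Rmax (Rabs (fst p - fst q)) (Rabs (snd p - snd q)).

Definition continuous_on01 (f : R -> R * R) : Prop :=
  forall t, in01 t -> forall eps, 0 < eps ->
    exists delta, 0 < delta /\
      forall s, in01 s -> Rabs (s - t) < delta -> pdist (f s) (f t) < eps.

(* pos : vertex positions; curve v w : parametrisation over [0,1] of the edge vw,
   oriented from v to w.  The same curve is used for vw and wv. *)
Definition on_edge_interior (curve : T -> T -> R -> R * R) (v w : T) (p : R * R) : Prop :=
  exists t, 0 < t < 1 /\ curve v w t = p.

Definition same_edge (e1 e2 : T * T) : Prop :=
  (fst e1 = fst e2 /\ snd e1 = snd e2) \/ (fst e1 = snd e2 /\ snd e1 = fst e2).

Definition is_drawing (pos : T -> R * R) (curve : T -> T -> R -> R * R) : Prop :=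
  (forall v w, pos v = pos w -> v = w) /\
  (forall v w, g v w ->
     [/\ continuous_on01 (curve v w),
         curve v w 0 = pos v /\ curve v w 1 = pos w,
         (forall s t, in01 s -> in01 t -> curve v w s = curve v w t -> s = t),
         (forall t, curve w v t = curve v w (1 - t)) &
         (forall t u, 0 < t < 1 -> curve v w t <> pos u)]) /\
  (forall p v1 w1 v2 w2 v3 w3,
     g v1 w1 -> g v2 w2 -> g v3 w3 ->
     on_edge_interior curve v1 w1 p -> on_edge_interior curve v2 w2 p ->
     on_edge_interior curve v3 w3 p ->
     same_edge (v1, w1) (v2, w2) \/ same_edge (v1, w1) (v3, w3) \/
     same_edge (v2, w2) (v3, w3)).

Definition crossing (curve : T -> T -> R -> R * R) (p : R * R) : Prop :=
  exists v w v' w', g v w /\ g v' w' /\ ~ same_edge (v, w) (v', w') /\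
    on_edge_interior curve v w p /\ on_edge_interior curve v' w' p.

Definition k_gap_planar_drawing (k : nat) (pos : T -> R * R)
  (curve : T -> T -> R -> R * R) : Prop :=
  is_drawing pos curve /\
  exists charge : R * R -> T * T,
    (forall p, crossing curve p ->
       g (fst (charge p)) (snd (charge p)) /\
       on_edge_interior curve (fst (charge p)) (snd (charge p)) p) /\
    (forall v w, g v w ->
       forall l : list (R * R), NoDup l ->
         (forall p, In p l -> crossing curve p /\ same_edge (charge p) (v, w)) ->
         (length l <= k)%nat).

Definition k_gap_planar (k : nat) : Prop :=
  exists pos curve, k_gap_planar_drawing k pos curve.

End Drawings.

(* Main.v *)
(* Fix a centre in every branch set and, for each edge xy of H, a path P_xy of at
   most 2r + 1 edges of G joining the two centres inside mu(x) and mu(y). At most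
   N = k(2r + 1) crossings are charged to edges of P_xy, so N branch sets "block"
   xy. Colour V(H) uniformly with N + 1 colours and keep xy if x and y share a
   colour that no blocker of xy has; this happens with probability at least
   1 / (3 (N + 1)). In one colour class the curves of kept edges without a common
   end are disjoint, which forces at most 3n edges on n vertices, so
   |E(H)| <= 9 (N + 1) |V(H)|.

   For the last bound no embedding is needed. Contracting an edge preserves the
   property that edges without a common end are drawn disjointly, so by Mader's
   argument for K5-minor-free graphs it is enough to exclude K5. After snapping the
   curves to a fine grid this follows from a parity law for disjoint lattice walks
   a -> b and c -> d, relating the winding numbers of each around the ends of the
   other to whether {a, b} and {c, d} interleave in the lexicographic order. *)
Require Import Defs.
From Stdlib Require Import Reals List ZArith Lia Lra Btauto ClassicalEpsilon.
From mathcomp Require Import all_boot all_algebra zify.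
From Coquelicot Require Compactness.
Import GRing.Theory Num.Theory.
Set Implicit Arguments.
Unset Strict Implicit.
Unset Printing Implicit Defensive.

(** * Parity of lattice walks *)

Section Lattice.
Local Open Scope Z_scope.

Definition point := (Z * Z)%type.

(** A step may also stay put: consecutive samples of a curve often snap to the same grid point. *)
Definition lstep (p q : point) : Prop :=
  (Z.abs (p.1 - q.1) + Z.abs (p.2 - q.2) <= 1).

Fixpoint lwalk (a : point) (l : list point) : Prop :=
  if l is b :: l' then lstep a b /\ lwalk b l' else True.

Definition ldisjoint (P Q : list point) : Prop :=
  forall x, In x P -> ~ In x Q.

(* The step pq is horizontal and meets the upward ray from c + (1/2, 0). *)
Definition above (p q c : point) : bool :=
  [&& Z.eqb (Z.min p.1 q.1) c.1, ~~ Z.eqb p.1 q.1 & Z.ltb c.2 p.2].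

(** The parity of the crossings with the ray above [c]: a winding number modulo 2 that makes sense
    for open walks too. *)
Fixpoint winding (a : point) (l : list point) (c : point) : bool :=
  if l is b :: l' then xorb (above a b c) (winding b l' c) else false.

(** Lexicographic, with the first coordinate decreasing. *)
Definition before (u v : point) : bool :=
  Z.ltb v.1 u.1 || (Z.eqb v.1 u.1 && Z.ltb u.2 v.2).

(** For distinct points: exactly one of [c], [d] lies between [a] and [b] in the order. *)
Definition interleave (a b c d : point) : bool :=
  xorb (xorb (before a c) (before a d)) (xorb (before b c) (before b d)).

Local Ltac separate := repeat match goal with
  | H : (?a, ?b) <> (?c, ?d) |- _ =>
      first [have {}H : b <> d by move=> E; apply: H; congr pair; lia | clear H]
  end.

Local Ltac decide_comparisons := repeat match goal with
  | |- context [Z.eqb ?a ?b] =>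
      first [rewrite (proj2 (Z.eqb_eq a b)); [|lia] | rewrite (proj2 (Z.eqb_neq a b)); [|lia]]
  | |- context [Z.ltb ?a ?b] =>
      first [rewrite (proj2 (Z.ltb_lt a b)); [|lia] | rewrite (proj2 (Z.ltb_ge a b)); [|lia]]
  end.

(** Only the relative position of the two steps matters, so this is a finite check over their
    directions and offsets. *)
Lemma above_reciprocity p q c d : lstep p q -> lstep c d ->
  p <> c -> p <> d -> q <> c -> q <> d ->
  xorb (xorb (above p q c) (above p q d)) (xorb (above c d p) (above c d q))
  = interleave p q c d.
Proof.
case: p q c d => [px py] [qx qy] [cx cy] [dx dy].
rewrite /lstep /interleave /before /above /= => s1 s2 n1 n2 n3 n4.
have H1 : (qx = px /\ (qy = py \/ qy = py + 1 \/ qy = py - 1)) \/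
    ((qx = px - 1 \/ qx = px + 1) /\ qy = py) by clear -s1; lia.
have H2 : (dx = cx /\ (dy = cy \/ dy = cy + 1 \/ dy = cy - 1)) \/
    ((dx = cx - 1 \/ dx = cx + 1) /\ dy = cy) by clear -s2; lia.
clear s1 s2.
(* Larger offsets decide all relevant comparisons at once, so each extreme range is a single
   case. *)
have X : px < cx - 2 \/ px = cx - 2 \/ px = cx - 1 \/ px = cx \/ px = cx + 1 \/
    px = cx + 2 \/ cx + 2 < px by clear; lia.
have Y : py < cy - 1 \/ py = cy - 1 \/ py = cy \/ py = cy + 1 \/ cy + 1 < py by clear; lia.
case: H1 => [[? H1]|[H1 ?]]; case: H2 => [[? H2]|[H2 ?]]; subst.
- rewrite !Z.eqb_refl /= !andbF /=.
  case: X => [?|[?|[?|[?|[?|[?|?]]]]]]; separate; try (by decide_comparisons);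
    case: Y => [?|[?|[?|[?|?]]]]; (try by decide_comparisons); exfalso; lia.
- case: H2 => ?; subst; case: X => [?|[?|[?|[?|[?|[?|?]]]]]]; separate; subst;
    try (by decide_comparisons);
    case: Y => [?|[?|[?|[?|?]]]]; (try by decide_comparisons); exfalso; lia.
- case: H1 => ?; subst; case: X => [?|[?|[?|[?|[?|[?|?]]]]]]; separate; subst;
    try (by decide_comparisons);
    case: Y => [?|[?|[?|[?|?]]]]; (try by decide_comparisons); exfalso; lia.
- case: H1 => ?; case: H2 => ?; subst;
    case: X => [?|[?|[?|[?|[?|[?|?]]]]]]; separate; subst; try (by decide_comparisons);
    case: Y => [?|[?|[?|[?|?]]]]; (try by decide_comparisons); exfalso; lia.
Qed.
End Lattice.

(** Both sides are additive modulo 2 when either walk is cut in two, so the law for single steps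
    sums up, first along [Q] (in [step]) and then along [P]. *)
Lemma winding_reciprocity a P c Q : lwalk a P -> lwalk c Q ->
  ldisjoint (a :: P) (c :: Q) ->
  xorb (xorb (winding a P c) (winding a P (last c Q)))
       (xorb (winding c Q a) (winding c Q (last a P)))
  = interleave a (last a P) c (last c Q).
Proof.
have step p q x R : lstep p q -> lwalk x R -> ldisjoint (p :: q :: nil) (x :: R) ->
    xorb (xorb (above p q x) (above p q (last x R)))
      (xorb (winding x R p) (winding x R q)) = interleave p q x (last x R).
  move=> spq; elim: R x => [|y R IH] x.
    by move=> _ _; rewrite /interleave /=; btauto.
  rewrite last_cons => -[sxy wR] dis.
  have Hl : xorb (xorb (above p q x) (above p q y)) (xorb (above x y p) (above x y q))
            = interleave p q x y.
    apply: above_reciprocity => // E; subst.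
    - by apply: (dis x); left.
    - by apply: (dis y); [left | right; left].
    - by apply: (dis x); [right; left | left].
    - by apply: (dis y); [right; left | right; left].
  have dis' : ldisjoint (p :: q :: nil) (y :: R) by move=> z /dis nz ?; apply: nz; right.
  move: Hl (IH y wR dis'); rewrite /interleave; set l := last y R => H1 H2.
  transitivity (xorb
    (xorb (xorb (above p q x) (above p q y)) (xorb (above x y p) (above x y q)))
    (xorb (xorb (above p q y) (above p q l)) (xorb (winding y R p) (winding y R q)))).
    by rewrite /=; btauto.
  by rewrite H1 H2; btauto.
elim: P a => [|b P IH] a.
  by move=> _ _ _; rewrite /interleave /=; btauto.
rewrite last_cons => -[sab wP] wQ dis.
have : xorb (xorb (above a b c) (above a b (last c Q)))
         (xorb (winding c Q a) (winding c Q b)) = interleave a b c (last c Q).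
  by apply: step => // z [<-|[<-|[]]]; apply: dis; [left | right; left].
have := IH b wP wQ (fun z zP => dis z (or_intror zP)).
rewrite /interleave; set l := last c Q; set m := last b P => H2 H1.
transitivity (xorb
  (xorb (xorb (above a b c) (above a b l)) (xorb (winding c Q a) (winding c Q b)))
  (xorb (xorb (winding b P c) (winding b P l)) (xorb (winding c Q b) (winding c Q m)))).
  by rewrite /=; btauto.
by rewrite H1 H2; btauto.
Qed.

Lemma before_antisym u v : u <> v -> before v u = ~~ before u v.
Proof.
case: u v => [x y] [x' y'] n; rewrite /before /=.
case: (Z.ltb_spec x' x) => ?; case: (Z.ltb_spec x x') => ?; try lia;
case: (Z.eqb_spec x' x) => ?; case: (Z.eqb_spec x x') => ?; try lia; subst => //=.
case: (Z.ltb_spec y y') => ?; case: (Z.ltb_spec y' y) => ? //; try lia.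
by case: n; congr pair; lia.
Qed.

(** * Excluding K5 *)

Section Drawn.
Variable S : finType.

(* Edges sharing an end are allowed to meet anywhere, which is what makes this
   property survive contractions. *)
Definition drawn (e : rel S) : Prop :=
  exists (c : S -> point) (L : S -> S -> list point),
    (forall u v, e u v -> lwalk (c u) (L u v) /\ last (c u) (L u v) = c v) /\
    (forall u v x y, e u v -> e x y -> u != x -> u != y -> v != x -> v != y ->
       ldisjoint (c u :: L u v) (c x :: L x y)).

Lemma last_in (a : point) l : In (last a l) (a :: l).
Proof. by elim: l a => [|b l IH] a; [left | rewrite last_cons; right]. Qed.

(* Summing the reciprocity law over the 15 pairs of independent edges, every
   winding number occurs twice while each 4-subset contributes one interleaving
   pair; so the sum is 0 = 5 modulo 2. *)
Lemma drawn_no_K5 e (s : seq S) : drawn e -> uniq s -> size s = 5 ->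
  {in s &, forall u v, u != v -> e u v} -> False.
Proof.
move=> [c [L [wL dL]]] Us size_s E; pose W u v x := winding (c u) (L u v) (c x).
have four u v x y : subseq [:: u; v; x; y] s ->
    xorb (xorb (xorb (xorb (W u v x) (W u v y)) (xorb (W x y u) (W x y v)))
               (xorb (xorb (W u x v) (W u x y)) (xorb (W v y u) (W v y x))))
         (xorb (xorb (W u y v) (W u y x)) (xorb (W v x u) (W v x y))) = true.
  move=> sub; have := subseq_uniq sub Us; have ms := mem_subseq sub.
  have [us vs xs ys] : [/\ u \in s, v \in s, x \in s & y \in s].
    by split; apply: ms; rewrite !inE eqxx ?orbT.
  rewrite /= !inE !negb_or => /and4P [/and3P [uv ux uy] /andP [vx vy] xy _].
  have pair p q p' q' : p \in s -> q \in s -> p' \in s -> q' \in s -> p != q -> p' != q' ->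
      p != p' -> p != q' -> q != p' -> q != q' ->
      [/\ c p <> c p', c p <> c q', c q <> c p', c q <> c q' &
      xorb (xorb (W p q p') (W p q q')) (xorb (W p' q' p) (W p' q' q))
        = interleave (c p) (c q) (c p') (c q')].
    move=> ps qs ps' qs' pq pq' n1 n2 n3 n4.
    have [w1 l1] := wL p q (E p q ps qs pq); have [w2 l2] := wL p' q' (E p' q' ps' qs' pq').
    have dis := dL p q p' q' (E p q ps qs pq) (E p' q' ps' qs' pq') n1 n2 n3 n4.
    have in1 := last_in (c p) (L p q); have in2 := last_in (c p') (L p' q').
    rewrite l1 in in1; rewrite l2 in in2.
    have := winding_reciprocity w1 w2 dis; rewrite l1 l2 => ->.
    split=> //.
    - by move=> eq; apply: (dis (c p)); [left | left].
    - by move=> eq; apply: (dis (c p)); [left | rewrite eq].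
    - by move=> eq; apply: (dis (c q)); [| left].
    - by move=> eq; apply: (dis (c q)); [| rewrite eq].
  have [_ _ vxc vyc ->] := pair u v x y us vs xs ys uv xy ux uy vx vy.
  have [| _ _ _ xyc ->] := pair u x v y us xs vs ys ux vy uv uy _ xy; first by rewrite eq_sym.
  have [||_ _ _ _ ->] := pair u y v x us ys vs xs uy vx uv ux; try by rewrite eq_sym.
  (* Modulo 2 the three interleavings cancel down to three sums such as [before v x] plus
     [before x v], each 1 by antisymmetry. *)
  rewrite /interleave (before_antisym vxc) (before_antisym vyc) (before_antisym xyc).
  by do 6!case: before.
case: s Us size_s E four => [|v1[|v2[|v3[|v4[|v5[|? ?]]]]]] // _ _ _ four.
set s := [:: v1; _; _; _; _] in four.
have m1 := four _ _ _ _ (mask_subseq [:: false; true; true; true; true] s).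
have m2 := four _ _ _ _ (mask_subseq [:: true; false; true; true; true] s).
have m3 := four _ _ _ _ (mask_subseq [:: true; true; false; true; true] s).
have m4 := four _ _ _ _ (mask_subseq [:: true; true; true; false; true] s).
have m5 := four _ _ _ _ (mask_subseq [:: true; true; true; true; false] s).
suff : xorb (xorb (xorb (xorb true true) true) true) true = false by [].
by rewrite -{1}m1 -{1}m2 -{1}m3 -{1}m4 -{1}m5; clear; btauto.
Qed.
End Drawn.

(** * Contraction and Mader's bound *)

Lemma lwalk_cat a l l' :
  lwalk a l -> lwalk (last a l) l' -> lwalk a (l ++ l').
Proof.
by elim: l a => [|b l IH] a //; rewrite last_cons => -[sab wl] wl'; split=> //; apply: IH.
Qed.

Lemma In_cat (z : point) l l' : In z (l ++ l') -> In z l \/ In z l'.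
Proof. exact: in_app_or. Qed.

Section Contraction.
Variable S : finType.
Implicit Types e : rel S.

Lemma drawn_sub e e' : subrel e' e -> drawn e -> drawn e'.
Proof.
move=> sub [c [L [wL dL]]]; exists c, L; split=> [u v /sub|u v x y /sub e1 /sub e2]; first exact: wL.
exact: dL.
Qed.

(* y is merged into x and left isolated. *)
Definition contract e (x y : S) : rel S := fun u v =>
  [&& u != y, v != y, u != v & [|| e u v, (u == x) && e y v | (v == x) && e u y]].

(** An edge created by the contraction follows an old edge at [y] and the walk of [xy]. If two
    independent new edges met, then so would two old edges taken from their walks, and these are
    independent as well. *)
Lemma drawn_contract e x y : symmetric e -> e x y -> drawn e -> drawn (contract e x y).
Proof.
move=> sym exy [c [L [wL dL]]].
pose L' u v := if e u v then L u v else
  if u == x then L x y ++ L y v else L u y ++ L y x.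
have eyx : e y x by rewrite sym.
exists c, L'; split.
  move=> u v /and4P [_ _ uv]; rewrite /L'.
  case: (boolP (e u v)) => [euv _|_ /= H]; first exact: wL.
  case: ifP H => [/eqP ux|_] /=.
    have -> : (v == x) = false by rewrite -ux eq_sym; apply: negbTE.
    rewrite orbF ux => eyv.
    have [w1 l1] := wL _ _ exy; have [w2 l2] := wL _ _ eyv.
    by split; [apply: lwalk_cat; rewrite ?l1 | rewrite last_cat l1 l2].
  case/andP=> /eqP -> euy.
  have [w1 l1] := wL _ _ euy; have [w2 l2] := wL _ _ eyx.
  by split; [apply: lwalk_cat; rewrite ?l1 | rewrite last_cat l1 l2].
(* The old vertices that may occur as ends along the walk of [uv]: its ends, and [y] if [x] is one
   of them. *)
pose within p u v := [|| p == u, p == v | (p == y) && ((u == x) || (v == x))].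
have cover u v z : contract e x y u v -> In z (c u :: L' u v) ->
    exists p q, [/\ e p q, In z (c p :: L p q), within p u v & within q u v].
  move=> /and4P [_ _ uv]; rewrite /L'.
  case: (boolP (e u v)) => [euv _ zin|_ /= H].
    by exists u, v; split=> //; rewrite /within eqxx ?orbT.
  case: ifP H => [/eqP ux|ux] /=.
    have -> : (v == x) = false by rewrite -ux eq_sym; apply: negbTE.
    rewrite orbF ux => eyv [<-|/In_cat [zin|zin]].
    - by exists x, y; split; rewrite /within ?eqxx ?orbT //; left.
    - by exists x, y; split; rewrite /within ?eqxx ?orbT //; right.
    - by exists y, v; split; rewrite /within ?eqxx ?orbT //; right.
  case/andP=> /eqP -> euy [<-|/In_cat [zin|zin]].
  - by exists u, y; split; rewrite /within ?eqxx ?orbT //; left.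
  - by exists u, y; split; rewrite /within ?eqxx ?orbT //; right.
  - by exists y, x; split; rewrite /within ?eqxx ?orbT //; right.
move=> u v u' v' e1 e2 n1 n2 n3 n4 z z1 z2.
have [p [q [epq zp pin qin]]] := cover _ _ _ e1 z1.
have [p' [q' [epq' zp' pin' qin']]] := cover _ _ _ e2 z2.
have sep a b : within a u v -> within b u' v' -> a != b.
  move: e1 e2 => /and4P [uy vy _ _] /and4P [uy' vy' _ _].
  move=> H1 H2; apply/eqP=> ab; subst b; move: H1 H2; rewrite /within.
  case/or3P=> [/eqP ?|/eqP ?|/andP [/eqP ? H1]]; subst;
    rewrite ?(negbTE n1) ?(negbTE n2) ?(negbTE n3) ?(negbTE n4) ?(negbTE uy) ?(negbTE vy) //=.
  rewrite eq_sym (negbTE uy') eq_sym (negbTE vy') eqxx /=.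
  by case/orP: H1 => /eqP ?; case/orP=> /eqP ?; subst;
    rewrite eqxx in n1 n2 n3 n4.
exact: (dL p q p' q' epq epq' (sep _ _ pin pin') (sep _ _ pin qin')
  (sep _ _ qin pin') (sep _ _ qin qin') z zp zp').
Qed.

Definition arcs e : {set S * S} := [set p | e p.1 p.2].

(** Arcs are ordered pairs. Contraction loses the two arcs of [xy] and, for each common neighbour
    [z], merges the two arcs of [yz] with those of [xz]. *)
Lemma arcs_contract e x y : symmetric e -> irreflexive e -> e x y ->
  #|arcs e| <= #|arcs (contract e x y)| + 2 + 2 * #|[set z | e x z && e y z]|.
Proof.
move=> sym irr exy; set C := [set z | _].
pose X0 := [set (x, y); (y, x)].
pose Y1 := [set (y, v) | v in C]; pose Y2 := [set (v, y) | v in C].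
pose X := X0 :|: Y1 :|: Y2; pose E1 := arcs e :\: X.
have cX : #|X| <= 2 + 2 * #|C|.
  rewrite mul2n -addnn addnA.
  apply: leq_trans (leq_card_setU _ _) _; rewrite leq_add ?leq_imset_card //.
  apply: leq_trans (leq_card_setU _ _) _; rewrite leq_add ?leq_imset_card //.
  by rewrite cards2; case: (_ == _).
have cE : #|arcs e| <= #|E1| + #|X|.
  apply: leq_trans (leq_card_setU _ _); apply: subset_leq_card.
  by apply/subsetP=> p; rewrite !inE => ->; rewrite andbT orNb.
(* Off [X], renaming [y] to [x] is injective on arcs and lands in the contraction. *)
pose m u := if u == y then x else u.
pose phi (p : S * S) := (m p.1, m p.2).
have inE1 u v : (u, v) \in E1 ->
    [/\ e u v, u != v, u = x -> v != y, u = y -> v != x /\ ~~ e x v & v = y -> ~~ e x u].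
  rewrite !inE !negb_or !xpair_eqE !negb_and => /andP [/andP [/andP [/andP [h1 h2] h3] h4] /= euv].
  have nuv : u != v by apply/eqP=> E; rewrite E irr in euv.
  split=> //.
  - by move=> ux; move: h1; rewrite ux eqxx.
  - move=> uy; split; first by move: h2; rewrite uy eqxx.
    apply/negP=> exv; move/negP: h3; apply; apply/imsetP; exists v; last by rewrite uy.
    by rewrite inE exv -uy.
  - move=> vy; apply/negP=> exu; move/negP: h4; apply; apply/imsetP; exists u; last by rewrite vy.
    by rewrite inE exu -vy sym.
have inj : {in E1 &, injective phi}.
  move=> [u v] [u' v'] /inE1 [e1 n1 a1 b1 c1] /inE1 [e2 n2 a2 b2 c2] [].
  rewrite /m; case: (u =P y) => [?|uy]; case: (u' =P y) => [?|uy']; subst;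
  case: (v =P y) => [?|vy]; case: (v' =P y) => [?|vy'] => *; subst => //;
  rewrite ?eqxx ?irr // in n1 n2 e1 e2.
  - by have [] := b1 erefl; rewrite ?eqxx.
  - by have [_ /negP] := b1 erefl.
  - by have := a1 erefl; rewrite eqxx.
  - by have [_ /negP] := b2 erefl.
  - by have := c1 erefl; rewrite sym e2.
  - by have := c2 erefl; rewrite sym e1.
have im : phi @: E1 \subset arcs (contract e x y).
  apply/subsetP=> _ /imsetP [[u v] /inE1 [e1 n1 a1 b1 c1] ->].
  have xy : x != y by apply/eqP=> E; rewrite E irr in exy.
  rewrite inE /contract /phi /m /=.
  case: (u =P y) => [uy|/eqP uy]; case: (v =P y) => [vy|/eqP vy]; subst; rewrite ?xy ?uy ?vy ?eqxx ?irr //= in n1 *.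
  - by have [vx _] := b1 erefl; rewrite (eq_sym x) vx e1 /= orbT.
  - rewrite e1 !orbT andbT; apply/eqP=> ux; by have := a1 ux; rewrite eqxx.
  - by rewrite n1 e1.
apply: leq_trans cE _; rewrite -addnA leq_add //.
by rewrite -(card_in_imset inj) subset_leq_card.
Qed.
End Contraction.

(** * The edge bound by Mader's argument *)

Section Mader.
Variable S : finType.
Implicit Types e : rel S.

Lemma drawn_no_K5_set e (K : {set S}) : drawn e -> #|K| = 5 ->
  {in K &, forall u v, u != v -> e u v} -> False.
Proof.
move=> dr cK E; apply: (drawn_no_K5 dr (enum_uniq K)); first by rewrite -cardE.
by move=> u v; rewrite !mem_enum; apply: E.
Qed.

Lemma contract_sym e x y : symmetric e -> symmetric (contract e x y).
Proof.
move=> sym u v; rewrite /contract (eq_sym u v) (sym u v) (sym y v) (sym u y).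
by rewrite andbCA (orbC (_ && _)).
Qed.

Lemma card_arcs e : #|arcs e| = \sum_u #|[set v | e u v]|.
Proof.
rewrite -sum1_card (eq_bigl (fun p : S * S => e p.1 p.2)); last by move=> p; rewrite inE.
rewrite -(pair_big_dep predT e (fun _ _ => 1)) /=.
by apply: eq_bigr => u _; rewrite -sum1_card; apply: eq_bigl => v; rewrite inE.
Qed.

(** Every vertex of the neighbourhood [N] has three neighbours in [N], so [N] has 4 or 5 vertices.
    If it has 4, it is complete and [v] completes a K5. If it has 5, non-adjacency in [N] is a
    matching: with no pair [N] is a K5, with one pair dropping an end leaves a K4, and with two
    pairs [ac], [bd] contracting [ab] leaves a K4. *)
Lemma wheel_K5_minor e v : symmetric e -> irreflexive e -> drawn e ->
  #|[set w | e v w]| <= 5 -> (exists w, e v w) ->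
  (forall x y, e x y -> 2 < #|[set z | e x z && e y z]|) -> False.
Proof.
move=> sym irr dr; set N := [set w | e v w] => cN5 [w0 vw0] tri.
have inN w : (w \in N) = e v w by rewrite inE.
have common w : w \in N -> 2 < #|[set z in N | e w z]|.
  rewrite inN => /tri; congr (2 < #|pred_of_set _|).
  by apply/setP=> z; rewrite !inE.
(* The three neighbours of [w] in [N] avoid [w] and [X], hence the 4. *)
have far w (X : {set S}) : w \in N -> X \subset N -> w \notin X ->
    (forall u, u \in X -> ~~ e w u) -> #|X| + 4 <= #|N|.
  move=> wN sX wX hX; have := common w wN.
  have sub : [set z in N | e w z] \subset N :\: (w |: X).
    apply/subsetP=> z; rewrite !inE => /andP [vz wz]; rewrite negb_or vz andbT.
    apply/andP; split; first by apply: contraTneq wz => ->; rewrite irr.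
    by apply: contraTN wz; apply: hX.
  have := subset_leq_card sub; rewrite cardsD (setIidPr _); last by rewrite subUset sub1set wN.
  have := subset_leq_card sX; rewrite cardsU1 wX; lia.
have cN4 : 4 <= #|N|.
  have := far w0 set0; rewrite inN vw0 sub0set cards0 inE; apply=> // u; by rewrite inE.
have vN : v \notin N by rewrite inN irr.
clear common tri w0 vw0; clearbody N.
have star (e' : rel S) (K : {set S}) : drawn e' -> symmetric e' ->
    {in K, forall u, e' v u} -> #|K| = 4 -> v \notin K ->
    {in K &, forall u w, u != w -> e' u w} -> False.
  move=> dr' sym' vK cK nvK H; apply: (@drawn_no_K5_set e' (v |: K)) => //.
    by rewrite cardsU1 nvK cK.
  move=> u w; rewrite !inE => /orP [/eqP ->|uK] /orP [/eqP ->|wK] => [|_|_|]; rewrite ?eqxx //.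
  - exact: vK.
  - by rewrite sym'; apply: vK.
  - exact: H.
case: (boolP [forall a in N, forall c in N, (a != c) ==> e a c]) => [/'forall_in_'forall_in_implyP H|].
  have HN : {in N &, forall u w, u != w -> e u w} by move=> u w uN wN; apply: H.
  case: (eqVneq #|N| 4) => cN.
    by apply: (star e N) => // u; rewrite inN.
  by apply: (@drawn_no_K5_set e N) => //; lia.
move=> /forall_inPn [a aN /forall_inPn [c cN']]; rewrite negb_imply => /andP [ac nac].
have ca : c != a by rewrite eq_sym.
have cN : #|N| = 5.
  have : #|[set c]| + 4 <= #|N|.
    by apply: (far a) => [//|||u]; rewrite ?sub1set ?inE // => /eqP ->.
  by rewrite cards1; lia.
(* With five vertices in [N], each misses at most one other. *)
have uniq_far w u1 u2 : w \in N -> u1 \in N -> u2 \in N -> w != u1 -> w != u2 ->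
    ~~ e w u1 -> ~~ e w u2 -> u1 = u2.
  move=> wN u1N u2N wu1 wu2 f1 f2; apply/eqP; apply: contraT => n12.
  have : #|[set u1; u2]| + 4 <= #|N|.
    apply: (far w) => [//|||u]; rewrite ?subUset ?sub1set ?inE ?u1N ?u2N ?negb_or ?wu1 //.
    by case/orP=> /eqP ->.
  by rewrite cards2 n12 cN.
have cA : #|N :\ c| = 4 by have := cardsD1 c N; rewrite cN' cN => -[].
case: (boolP [forall b in N :\ c, forall d in N :\ c, (b != d) ==> e b d]).
  move=> /'forall_in_'forall_in_implyP H.
  apply: (star e (N :\ c)) => // [u||].
  - by rewrite in_setD1 inN => /andP [].
  - by rewrite in_setD1 (negbTE vN) andbF.
  - by move=> u w uN wN; apply: H.
move=> /forall_inPn [b bN /forall_inPn [d dN]]; rewrite negb_imply => /andP [bd nbd].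
move: bN dN; rewrite !in_setD1 => /andP [bc bN] /andP [dc dN].
have sN u w : ~~ e u w -> ~~ e w u by rewrite sym.
have ba : b != a.
  apply: contraNneq dc => ba; rewrite ba in bd nbd; apply/eqP.
  exact: (uniq_far a d c aN dN cN' bd ac nbd nac).
have da : d != a.
  apply: contraNneq bc => da; rewrite da in bd nbd; apply/eqP; rewrite eq_sym in bd.
  exact: (uniq_far a b c aN bN cN' bd ac (sN _ _ nbd) nac).
have eab : e a b.
  apply: contraNT bc => nab; apply/eqP; rewrite eq_sym in ba.
  exact: (uniq_far a b c aN bN cN' ba ac nab nac).
have cB : #|N :\ b| = 4 by have := cardsD1 b N; rewrite bN cN => -[].
(* A third missing pair would be disjoint from [ac] and [bd] and need six vertices. *)
have main u w : u \in N -> w \in N -> u != b -> w != b -> u != w -> u != c -> w != c ->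
   u != a -> w != a -> e u w.
  move=> uN wN ub wb uw uc wc ua wa; apply: contraT => nuw.
  have : size [:: a; b; c; d; u; w] <= size (enum N).
    apply: uniq_leq_size.
      rewrite /= !inE !negb_or ac bd bc uw (eq_sym a b) ba (eq_sym a d) da (eq_sym a u) ua.
      rewrite (eq_sym a w) wa (eq_sym b u) ub (eq_sym b w) wb (eq_sym c d) dc (eq_sym c u) uc.
      rewrite (eq_sym c w) wc /= andbT; apply/andP; split.
        apply: contraNneq wb => du; apply/eqP.
        by apply: (uniq_far u w b uN wN bN uw ub nuw); rewrite -du; apply: sN.
      apply: contraNneq ub => dw; apply/eqP; rewrite eq_sym in uw.
      by apply: (uniq_far w u b wN uN bN uw wb (sN _ _ nuw)); rewrite -dw; apply: sN.
    by move=> z; rewrite !inE => /or4P [/eqP ->|/eqP ->|/eqP ->|/or3P [/eqP ->|/eqP ->|/eqP ->]]; rewrite mem_enum.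
  by rewrite -cardE cN.
have near u : u \in N -> u != a -> u != c -> e u a /\ e u c.
  move=> uN ua uc; split; apply: contraT => n.
    by case/eqP: uc; apply: (uniq_far a u c aN uN cN' _ ac (sN _ _ n) nac); rewrite eq_sym.
  by case/eqP: ua; apply: (uniq_far c u a cN' uN aN _ ca (sN _ _ n) (sN _ _ nac)); rewrite eq_sym.
have ebc : e b c by have [] := near b bN ba bc.
(* Merging [b] into [a] repairs the pair [ac] through the edge [bc] and removes the pair [bd]. *)
apply: (star (contract e a b) (N :\ b)) => //.
- exact: drawn_contract.
- exact: contract_sym.
- move=> u; rewrite in_setD1 /contract => /andP [ub uN]; have vu : e v u by rewrite -inN.
  rewrite ub vu !andbT; apply/andP; split; last by apply: contraNneq vN => ->.
  by apply: contraNneq vN => ->.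
- by rewrite in_setD1 (negbTE vN) andbF.
move=> u w; rewrite !in_setD1 /contract => /andP [ub uN] /andP [wb wN] uw; rewrite ub wb uw /=.
case: (boolP (e u w)) => //= nuw; have wu : w != u by rewrite eq_sym.
case: (eqVneq u a) => [ua|ua] /=.
  rewrite ua in uw nuw.
  by rewrite (uniq_far a w c aN wN cN' uw ac nuw nac) ebc.
case: (eqVneq w a) => [wa|wa] /=.
  rewrite wa in wu nuw.
  by rewrite (uniq_far a u c aN uN cN' wu ac (sN _ _ nuw) nac) sym ebc.
case: (eqVneq u c) => [uc|uc].
  rewrite uc in uw nuw.
  by case/eqP: wa; apply: (uniq_far c w a cN' wN aN uw ca nuw (sN _ _ nac)).
case: (eqVneq w c) => [wc|wc].
  rewrite wc in wu nuw.
  by case/eqP: ua; apply: (uniq_far c u a cN' uN aN wu ca (sN _ _ nuw) (sN _ _ nac)).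
by case/negP: nuw; apply: main.
Qed.

Lemma contract_irr e x y : irreflexive (contract e x y).
Proof. by move=> u; rewrite /contract eqxx !andbF. Qed.

(* Mader's argument: in a minimal counterexample every edge lies in three
   triangles, so the neighbourhood of a vertex of degree at most 5 is dense
   enough to contain a K4 minor. *)
Lemma drawn_arcs e (A : {set S}) : symmetric e -> irreflexive e -> drawn e ->
  (forall u v, e u v -> u \in A) -> A != set0 -> #|arcs e| + 4 <= 6 * #|A|.
Proof.
have [n] := ubnP #|A|; elim: n e A => // n IHn e A cA.
have [m] := ubnP #|arcs e|; elim: m e => // m IHm e ce sym irr dr sup A0.
have Apos : 0 < #|A| by rewrite card_gt0.
rewrite leqNgt; apply/negP=> big.
have remove y x : y \in A -> x \in A -> x != y -> #|A :\ y| = #|A|.-1 /\ A :\ y != set0.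
  move=> yA xA xy; split; first by rewrite (cardsD1 y A) yA.
  by apply/set0Pn; exists x; rewrite in_setD1 xy.
have tri x y : e x y -> 2 < #|[set z | e x z && e y z]|.
  move=> exy; rewrite ltnNge; apply/negP=> few.
  have xy : x != y by apply/eqP=> E; rewrite E irr in exy.
  have xA := sup _ _ exy; have yA : y \in A by apply: (sup y x); rewrite sym.
  have [cA' nA'] := remove y x yA xA xy.
  (* With at most two common neighbours at most 2 + 4 = 6 arcs are lost, which is the share of the
     one vertex removed from [A]. *)
  have := arcs_contract sym irr exy.
  have : #|arcs (contract e x y)| + 4 <= 6 * #|A :\ y|.
    apply: IHn => //; first by rewrite cA'; lia.
    - exact: contract_sym.
    - exact: contract_irr.
    - exact: drawn_contract.
    move=> u v /and4P [uy _ _ H]; rewrite in_setD1 uy /=.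
    by case/or3P: H => [/sup|/andP [/eqP -> _]|/andP [_ /sup]].
  by rewrite cA'; lia.
have [/existsP [v /andP [vA dv]]|] := boolP [exists v in A, #|[set w | e v w]| <= 5].
  have [/existsP vw|] := boolP [exists w, e v w].
    exact: (wheel_K5_minor sym irr dr dv vw tri).
  (* An isolated vertex is dropped from [A]; if nothing remains, there are no arcs and 4 <= 6. *)
  rewrite negb_exists => /forallP iso.
  have sup' u w : e u w -> u \in A :\ v.
    move=> euw; rewrite in_setD1 (sup _ _ euw) andbT; apply/eqP=> uv.
    by have := iso w; rewrite -uv euw.
  case: (eqVneq (A :\ v) set0) => [E0|nA'].
    have : arcs e = set0.
      by apply/setP=> -[u w]; rewrite !inE; apply/negP=> /sup'; rewrite E0 inE.
    by move=> E; move: big; rewrite E cards0; lia.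
  have cA' : #|A :\ v| = #|A|.-1 by rewrite (cardsD1 v A) vA.
  have : #|arcs e| + 4 <= 6 * #|A :\ v| by apply: IHn => //; rewrite cA'; lia.
  by rewrite cA'; lia.
rewrite negb_exists => /forallP deg.
have many : 6 * #|A| <= #|arcs e|.
  rewrite card_arcs mulnC -sum_nat_const big_mkcond /=; apply: leq_sum => u _.
  by case: ifP => // uA; have := deg u; rewrite uA /= -ltnNge.
have /card_gt0P [[x y]] : 0 < #|arcs e| by lia.
rewrite inE /= => exy.
(* All degrees are now at least 6, so after deleting a single edge there are still at least
   [6 * #|A| - 2] arcs, too many for the induction hypothesis. *)
pose e' u v := e u v && ((u, v) \notin [set (x, y); (y, x)]).
have ee : arcs e' = arcs e :\: [set (x, y); (y, x)].
  by apply/setP=> -[u v]; rewrite !inE /e' /= !inE andbC.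
have xy : x != y by apply/eqP=> E; rewrite E irr in exy.
have ce' : #|arcs e'| = #|arcs e| - 2.
  rewrite ee cardsD (setIidPr _) ?cards2; last by rewrite subUset !sub1set !inE /= exy sym exy.
  by rewrite xpair_eqE (negbTE xy).
have : #|arcs e'| + 4 <= 6 * #|A|.
  apply: IHm => //; first by rewrite ce'; lia.
  - move=> u v; rewrite /e' (sym u v) !inE !xpair_eqE.
    by congr (_ && ~~ _); rewrite orbC; congr orb; apply: andbC.
  - by move=> u; rewrite /e' irr.
  - by apply: drawn_sub dr => u v /andP [].
  - by move=> u v /andP [/sup].
by rewrite ce'; lia.
Qed.
End Mader.

(** * From curves to lattice walks *)

Section Discretisation.
Local Open Scope R_scope.

Lemma pdist_lt p q e : pdist p q < e <-> Rabs (p.1 - q.1) < e /\ Rabs (p.2 - q.2) < e.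
Proof.
rewrite /pdist; split=> [H|[]]; last exact: Rmax_lub_lt.
by split; apply: Rle_lt_trans H; [apply: Rmax_l | apply: Rmax_r].
Qed.

Lemma pdist_gt0 p q : p <> q -> 0 < pdist p q.
Proof.
move=> npq; apply: Rnot_le_lt => H; apply: npq.
have H1 := Rle_trans _ _ _ (Rmax_l _ _) H; have H2 := Rle_trans _ _ _ (Rmax_r _ _) H.
case: p q H1 H2 {H} => [x y] [x' y'] /=; split_Rabs => *; congr pair; lra.
Qed.

Lemma pdist_triangle p q r : pdist p r <= pdist p q + pdist q r.
Proof.
have H1 := Rmax_l (Rabs (p.1 - q.1)) (Rabs (p.2 - q.2)).
have H2 := Rmax_r (Rabs (p.1 - q.1)) (Rabs (p.2 - q.2)).
have H3 := Rmax_l (Rabs (q.1 - r.1)) (Rabs (q.2 - r.2)).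
have H4 := Rmax_r (Rabs (q.1 - r.1)) (Rabs (q.2 - r.2)).
by rewrite /pdist; apply: Rmax_lub; split_Rabs; lra.
Qed.

Lemma pdistC p q : pdist p q = pdist q p.
Proof. by rewrite /pdist Rabs_minus_sym (Rabs_minus_sym p.2). Qed.

(** Outside [0, 1] any gauge will do; the compactness theorem asks for one at every real. *)
Lemma choose_gauge (f : R -> R * R) (t e : R) : continuous_on01 f -> 0 < e ->
  exists d : posreal, in01 t -> forall s, in01 s -> Rabs (s - t) < d -> pdist (f s) (f t) < e.
Proof.
move=> cf e0; case: (classic (in01 t)) => [tI|ntI].
  by have [d [d0 H]] := cf t tI e e0; exists (mkposreal d d0) => _.
by exists (mkposreal e e0).
Qed.

Lemma uniformly_continuous f e : continuous_on01 f -> 0 < e ->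
  exists2 d : R, 0 < d & forall s t, in01 s -> in01 t -> Rabs (s - t) < d -> pdist (f s) (f t) < e.
Proof.
move=> cf e0; have e2 : 0 < e / 2 by lra.
have ch t : {d : posreal | in01 t -> forall s, in01 s -> Rabs (s - t) < d -> pdist (f s) (f t) < e / 2}.
  exact/constructive_indefinite_description/choose_gauge.
(* Half the gauge, so that [s] and every [t] close to it lie within the full gauge of one centre. *)
have h t : 0 < sval (ch t) / 2 by have := cond_pos (sval (ch t)); lra.
have [d H] := Compactness.compactness_value_1d 0 1 (fun t => mkposreal _ (h t)).
exists d; first exact: cond_pos.
move=> s t sI tI st; apply: NNPP => n; apply: (H s sI) => -[u [uI /= [su du]]]; apply: n.
have Hu := svalP (ch u) uI.
have d1 := Hu s sI; have d2 := Hu t tI; have := pdist_triangle (f s) (f u) (f t).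
rewrite (pdistC (f u)); have p0 := cond_pos (sval (ch u)).
have {}d1 : pdist (f s) (f u) < e / 2 by apply: d1; lra.
have {}d2 : pdist (f t) (f u) < e / 2 by apply: d2; move: su st; split_Rabs; lra.
by lra.
Qed.

Lemma separated f h : continuous_on01 f -> continuous_on01 h ->
  (forall s t, in01 s -> in01 t -> f s <> h t) ->
  exists2 d : R, 0 < d & forall s t, in01 s -> in01 t -> d <= pdist (f s) (h t).
Proof.
move=> cf ch dis.
(* Moving each point by less than a third of the distance leaves more than a third, which bounds the
   gauge [d] from above. *)
have ex s t : exists d : posreal, in01 s -> in01 t ->
    [/\ forall x, in01 x -> Rabs (x - s) < d -> pdist (f x) (f s) < pdist (f s) (h t) / 3,
        forall y, in01 y -> Rabs (y - t) < d -> pdist (h y) (h t) < pdist (f s) (h t) / 3 &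
        d <= pdist (f s) (h t) / 3].
  case: (classic (in01 s /\ in01 t)) => [[sI tI]|n]; last first.
    by exists (mkposreal 1 Rlt_0_1) => sI tI; case: n.
  have e0 : 0 < pdist (f s) (h t) / 3 by have := pdist_gt0 (dis s t sI tI); lra.
  have [d1 H1] := choose_gauge s cf e0; have [d2 H2] := choose_gauge t ch e0.
  have m0 : 0 < Rmin (Rmin d1 d2) (pdist (f s) (h t) / 3).
    by apply: Rmin_pos => //; apply: Rmin_pos; apply: cond_pos.
  have m1 := Rmin_l (Rmin d1 d2) (pdist (f s) (h t) / 3).
  have m2 := Rmin_r (Rmin d1 d2) (pdist (f s) (h t) / 3).
  have m3 := Rmin_l d1 d2; have m4 := Rmin_r d1 d2.
  exists (mkposreal _ m0) => _ _; split=> //=.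
  - by move=> x xI xs; apply: H1 => //; lra.
  - by move=> x xI xs; apply: H2 => //; lra.
pose ch' s t := constructive_indefinite_description _ (ex s t).
have [d H] := Compactness.compactness_value_2d 0 1 0 1 (fun s t => sval (ch' s t)).
exists d; first exact: cond_pos.
move=> s t sI tI; apply: Rnot_lt_le => lt.
apply: (H s t sI tI) => -[u [v [uI [vI [su [tv du]]]]]].
have [Hf Hh Hd] := svalP (ch' u v) uI vI.
have {Hf} := Hf s sI su; have {Hh} := Hh t tI tv.
have := pdist_triangle (f u) (f s) (h v); have := pdist_triangle (f s) (h t) (h v).
rewrite (pdistC (f u) (f s)).
by lra.
Qed.

Lemma uniform_pos (I : finType) (P : I -> R -> Prop) :
  (forall i d d', d' <= d -> P i d -> P i d') ->
  (forall i, exists2 d, 0 < d & P i d) -> exists2 d, 0 < d & forall i, P i d.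
Proof.
move=> mono ex.
suff [d d0 H] : exists2 d, 0 < d & forall i, i \in enum I -> P i d.
  by exists d => // i; apply: H; rewrite mem_enum.
elim: (enum I) => [|i s [d d0 H]]; first by exists 1; [lra|].
have [d' d0' Hi] := ex i; exists (Rmin d d'); first exact: Rmin_pos.
move=> j; rewrite in_cons => /orP [/eqP ->|/H Hj].
  exact: mono (Rmin_r _ _) Hi.
exact: mono (Rmin_l _ _) Hj.
Qed.

(** * Snapping curves to a grid *)

Definition snap (d : R) (p : R * R) : point := (Int_part (p.1 / d), Int_part (p.2 / d)).

(** Rounding costs up to [d], and a corner inserted between two samples up to another [d]. *)
Definition nearby (d : R) (z : point) (p : R * R) : Prop :=
  Rabs (IZR z.1 * d - p.1) <= 2 * d /\ Rabs (IZR z.2 * d - p.2) <= 2 * d.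

Lemma Int_part_close d x : 0 < d -> IZR (Int_part (x / d)) * d <= x < IZR (Int_part (x / d)) * d + d.
Proof.
move=> d0; have [H1 H2] := base_Int_part (x / d).
have E : x / d * d = x by field; lra.
have := Rmult_le_compat_r d _ _ (Rlt_le _ _ d0) H1.
have : IZR (Int_part (x / d)) * d > (x / d - 1) * d by apply: Rmult_gt_compat_r => //; lra.
by rewrite Rmult_minus_distr_r E; lra.
Qed.

Lemma Int_part_step d x y : 0 < d -> Rabs (x - y) < d ->
  Z.le (Z.abs (Int_part (x / d) - Int_part (y / d))) 1.
Proof.
move=> d0 xy; have := Int_part_close x d0; have := Int_part_close y d0.
move: (Int_part _) (Int_part _) => m n [m1 m2] [n1 n2].
have lt (a b : Z) : IZR a * d < IZR b * d + 2 * d -> Z.lt a (b + 2).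
  move=> H; apply: lt_IZR; rewrite plus_IZR; apply: (Rmult_lt_reg_r d) => //; lra.
move: xy; split_Rabs => *; have := lt n m ltac:(lra); have := lt m n ltac:(lra); lia.
Qed.

Lemma snap_walk d n (q : nat -> R * R) : 0 < d ->
  (forall i, (i < n)%N -> pdist (q i.+1) (q i) < d) ->
  exists l, [/\ lwalk (snap d (q O)) l, last (snap d (q O)) l = snap d (q n) &
    forall z, In z (snap d (q O) :: l) -> exists2 i, (i <= n)%N & nearby d z (q i)].
Proof.
move=> d0; elim: n => [|n IH] H.
  exists nil; split=> // z [<-|[]]; exists O => //.
  have := Int_part_close (q O).1 d0; have := Int_part_close (q O).2 d0.
  by rewrite /nearby /=; split_Rabs; lra.
have [i iN|l [wl el nl]] := IH; first by apply: H; rewrite ltnS ltnW.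
have /pdist_lt [s1 s2] := H n (ltnSn n).
(* Consecutive samples may snap to diagonal neighbours; the corner [m] changes one coordinate at a
   time. *)
pose m : point := (Int_part ((q n.+1).1 / d), Int_part ((q n).2 / d)).
exists (l ++ [:: m; snap d (q n.+1)]); split.
- apply: lwalk_cat => //; rewrite el /= /lstep /=; split; [|split=> //].
    by have := Int_part_step d0 s1; rewrite -Z.abs_opp; lia.
  by have := Int_part_step d0 s2; rewrite -Z.abs_opp; lia.
- by rewrite last_cat.
move=> z; rewrite -cat_cons => /In_cat [/nl [i ii zi]|]; first by exists i => //; apply: leqW.
have c1 := Int_part_close (q n.+1).1 d0; have c2 := Int_part_close (q n.+1).2 d0.
have c3 := Int_part_close (q n).2 d0.
case=> [<-|[<-|[]]].
- by exists n => //; move: s1 s2 c1 c3; rewrite /nearby /=; split_Rabs; lra.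
- by exists n.+1 => //; move: c1 c2; rewrite /nearby /=; split_Rabs; lra.
Qed.

Lemma snap_curve d f : 0 < d -> continuous_on01 f ->
  exists l, [/\ lwalk (snap d (f 0)) l, last (snap d (f 0)) l = snap d (f 1) &
    forall z, In z (snap d (f 0) :: l) -> exists2 t, in01 t & nearby d z (f t)].
Proof.
move=> d0 cf; have [e e0 He] := uniformly_continuous cf d0.
have [n [n0 ne]] : exists n, (0 < n)%N /\ / INR n < e.
  have [n [H1 H2]] := archimed_cor1 e e0; exists n; split=> //; exact/ltP.
have n0' : 0 < INR n by apply: lt_0_INR; apply/ltP.
pose q i := f (INR i / INR n).
have in01q i : (i <= n)%N -> in01 (INR i / INR n).
  move=> /leP /le_INR H; have := pos_INR i => ?; split.
    by apply: Rmult_le_pos => //; apply/Rlt_le/Rinv_0_lt_compat.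
  by apply: (Rmult_le_reg_r (INR n)) => //; rewrite /Rdiv Rmult_assoc Rinv_l; lra.
have [i ii|l] := @snap_walk d n q d0.
  apply: He; [exact: in01q | by apply: in01q; apply: ltnW |].
  have -> : INR i.+1 / INR n - INR i / INR n = / INR n by rewrite S_INR; field; lra.
  by rewrite Rabs_right //; apply/Rle_ge/Rlt_le/Rinv_0_lt_compat.
rewrite /q /Rdiv Rmult_0_l Rinv_r; last by lra.
move=> [wl el nl]; exists l; split=> // z /nl [i ii zi]; exists (INR i / INR n) => //.
exact: in01q.
Qed.

(** Disjoint compact curves have positive distance. There are finitely many pairs of edges, so one
    grid is fine enough for all. *)
Lemma discretise (T : finType) (g : rel T) (pos : T -> R * R) (curve : T -> T -> R -> R * R) :
  (forall v w, g v w ->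
    [/\ continuous_on01 (curve v w), curve v w 0 = pos v & curve v w 1 = pos w]) ->
  exists (c : T -> point) (L : T -> T -> list point),
    (forall v w, g v w -> lwalk (c v) (L v w) /\ last (c v) (L v w) = c w) /\
    (forall v w v' w', g v w -> g v' w' ->
      (forall s t, in01 s -> in01 t -> curve v w s <> curve v' w' t) ->
      ldisjoint (c v :: L v w) (c v' :: L v' w')).
Proof.
move=> C.
pose P (i : T * T * (T * T)) d := g i.1.1 i.1.2 -> g i.2.1 i.2.2 ->
  (forall s t, in01 s -> in01 t -> curve i.1.1 i.1.2 s <> curve i.2.1 i.2.2 t) ->
  forall s t, in01 s -> in01 t -> d <= pdist (curve i.1.1 i.1.2 s) (curve i.2.1 i.2.2 t).
have [||e e0 He] := @uniform_pos _ P.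
- by move=> i d d' dd' H g1 g2 D s t sI tI; apply: Rle_trans dd' _; apply: H.
- move=> [[v w] [v' w']]; rewrite /P /=.
  case: (classic (g v w /\ g v' w' /\ (forall s t, in01 s -> in01 t -> curve v w s <> curve v' w' t))).
    move=> [g1 [g2 D]]; have [C1 _ _] := C v w g1; have [C2 _ _] := C v' w' g2.
    by have [d d0 H] := separated C1 C2 D; exists d.
  by move=> n; exists 1; [lra|] => g1 g2 D; case: n.
(* Curve points near a common grid point are at most [4 * d] apart, less than [e]. *)
pose d := e / 5; have d0 : 0 < d by rewrite /d; lra.
have ex (i : T * T) : exists l, g i.1 i.2 ->
   [/\ lwalk (snap d (pos i.1)) l, last (snap d (pos i.1)) l = snap d (pos i.2) &
   forall z, In z (snap d (pos i.1) :: l) -> exists2 t, in01 t & nearby d z (curve i.1 i.2 t)].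
  case: i => v w /=; case: (boolP (g v w)) => [gvw|_]; last by exists nil.
  have [C1 C2 C3] := C v w gvw; have [l Hl] := snap_curve d0 C1.
  by exists l => _; rewrite -C2 -C3.
have [L HL] := fin_all_exists ex.
exists (fun v => snap d (pos v)), (fun v w => L (v, w)); split.
  by move=> v w /(HL (v, w)) [].
move=> v w v' w' g1 g2 D z z1 z2.
have [_ _ /(_ z z1) [s sI [a1 b1]]] := HL (v, w) g1.
have [_ _ /(_ z z2) [t tI [a2 b2]]] := HL (v', w') g2.
have := He ((v, w), (v', w')) g1 g2 D s t sI tI; apply: Rlt_not_le.
apply/pdist_lt; move: a1 a2 b1 b2; rewrite /d /=; split_Rabs; lra.
Qed.

End Discretisation.

(** * Random colouring *)

Lemma lwalk_rev (a : point) l : lwalk a l ->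
  [/\ lwalk (last a l) (rev (belast a l)), last (last a l) (rev (belast a l)) = a &
      forall z, In z (last a l :: rev (belast a l)) -> In z (a :: l)].
Proof.
elim: l a => [|b l IH] a //= [sab /IH [wl el il]].
rewrite rev_cons -cats1; split.
- apply: lwalk_cat => //; rewrite el /=; split=> //; move: sab; rewrite /lstep; lia.
- by rewrite last_cat.
move=> z [<-|/In_cat [zin|[<-|[]]]]; last by left.
- by right; apply: il; left.
- by right; apply: il; right.
Qed.

Section Exponential.
Local Open Scope R_scope.

Lemma INR_expn m n : INR (expn m n) = INR m ^ n.
Proof. by elim: n => [|n IH] //; rewrite expnS mult_INR IH. Qed.

(** This is (1 + 1/n)^n <= e <= 3; for n = 0 both powers are 1. *)
Lemma expn_succ_le n : (n.+1 ^ n <= 3 * n ^ n)%N.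
Proof.
case: n => [//|n]; set m := n.+1; have m0 : 0 < INR m by apply: lt_0_INR; apply/ltP.
have expX x k : exp x ^ k = exp (INR k * x).
  elim: k => [|k IH]; first by rewrite Rmult_0_l exp_0.
  by rewrite -tech_pow_Rmult IH -exp_plus S_INR; congr exp; ring.
have le1 : 1 + / INR m <= exp (/ INR m) by apply: exp_ineq1_le.
have i0 : 0 < / INR m by apply: Rinv_0_lt_compat.
have : (1 + / INR m) ^ m <= exp 1.
  have -> : 1 = INR m * / INR m by rewrite Rinv_r //; lra.
  by rewrite -expX; apply: pow_incr; rewrite Rinv_r; lra.
move=> le2; apply/leP; apply: INR_le; rewrite mult_INR !INR_expn S_INR.
have -> : INR m + 1 = INR m * (1 + / INR m) by field; lra.
rewrite Rpow_mult_distr Rmult_comm; apply: Rmult_le_compat_r; first by apply: pow_le; lra.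
by apply: Rle_trans le2 _; apply: Rle_trans exp_le_3 _ => /=; lra.
Qed.
End Exponential.

(** * Counting edges kept by a colouring *)

Section Sampling.
Variables (S : finType) (h : rel S) (N : nat).
Variables (c : S -> point) (L : S -> S -> list point) (B : S -> S -> {set S}).
Hypothesis hirr : irreflexive h.
Hypothesis walks : forall x y, h x y -> lwalk (c x) (L x y) /\ last (c x) (L x y) = c y.
Hypothesis blockers : forall x y, h x y -> [/\ #|B x y| <= N, x \notin B x y & y \notin B x y].
Hypothesis crossings : forall x y u v, h x y -> h u v ->
  x != u -> x != v -> y != u -> y != v ->
  ldisjoint (c x :: L x y) (c u :: L u v) \/
  [|| u \in B x y, v \in B x y, x \in B u v | y \in B u v].

Implicit Types f : {ffun S -> 'I_N.+1}.

(** Selects one orientation of each edge. *)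
Definition upward x y := h x y && (enum_rank x < enum_rank y).

Definition good f x y :=
  [&& f x == f y & [forall z in B x y, f z != f x]].

(** Two kept edges of the same colour never block each other, since blockers have a different
    colour. If they have no common end they are therefore drawn disjointly, and Mader's bound
    applies. The factor 2 turns edges into arcs. *)
Lemma good_edges_class f i :
  2 * #|[set p : S * S | [&& upward p.1 p.2, good f p.1 p.2 & f p.1 == i]]|
  <= 6 * #|[set u | f u == i]|.
Proof.
pose b u v := [&& upward u v, good f u v & f u == i].
pose e u v := b u v || b v u.
have bh u v : b u v -> h u v by case/and3P => /andP [].
have bi u v : b u v -> f u = i /\ f v = i.
  by case/and3P => _ /andP [/eqP <- _] /eqP ->.
have asym u v : b u v -> b v u = false.
  by case/and3P => /andP [_ r1] _ _; apply/negP; case/and3P => /andP [_ r2]; move: r1 r2; lia.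
have bB u v x : b u v -> f x = i -> x \notin B u v.
  move=> /and3P [_ /andP [_ /forall_inP H] /eqP fu] fx; apply/negP=> /H.
  by rewrite fx fu eqxx.
case: (eqVneq [set u | f u == i] set0) => [E0|A0].
  suff -> : [set p : S * S | [&& upward p.1 p.2, good f p.1 p.2 & f p.1 == i]] = set0.
    by rewrite cards0.
  apply/setP=> -[u v]; rewrite in_set0 inE /=; apply/negP=> /bi [fu _].
  by have : u \in [set u | f u == i]; [rewrite inE fu | rewrite E0 inE].
have dr : drawn e.
  (* [b] holds in one direction only; the opposite arc gets the reversed walk. *)
  pose L' u v := if b u v then L u v else rev (belast (c v) (L v u)).
  have L'P u v : e u v -> [/\ lwalk (c u) (L' u v), last (c u) (L' u v) = c v &
     exists x y, [/\ b x y, (x = u /\ y = v) \/ (x = v /\ y = u) &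
      forall z, In z (c u :: L' u v) -> In z (c x :: L x y)]].
    rewrite /L' /e; case: (boolP (b u v)) => [buv _|_ /= bvu].
      by have [w l] := walks (bh _ _ buv); split=> //; exists u, v; split=> //; left.
    have [w l] := walks (bh _ _ bvu); have [w' l' sub] := lwalk_rev w.
    rewrite l in w' l' sub; split=> //.
    by exists v, u; split=> //; right.
  exists c, L'; split=> [u v /L'P []|] // u v x y /L'P [_ _ [p [q [bpq epq inpq]]]].
  move=> /L'P [_ _ [p' [q' [bpq' epq' inpq']]]] ux uy vx vy.
  have [n1 n2 n3 n4] : [/\ p != p', p != q', q != p' & q != q'].
    by case: epq epq' => -[-> ->] [] [-> ->].
  have [fp fq] := bi _ _ bpq; have [fp' fq'] := bi _ _ bpq'.
  case: (crossings (bh _ _ bpq) (bh _ _ bpq') n1 n2 n3 n4) => [dis z /inpq z1 /inpq' z2|].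
    by apply: (dis z).
  by rewrite !(negbTE (bB _ _ _ _ _)).
have := @drawn_arcs S e [set u | f u == i] _ _ dr _ A0.
have sube : arcs e = [set p | b p.1 p.2] :|: [set p | b p.2 p.1].
  by apply/setP=> p; rewrite !inE.
have swap : #|[set p : S * S | b p.2 p.1]| = #|[set p : S * S | b p.1 p.2]|.
  have inj : injective (fun p : S * S => (p.2, p.1)) by move=> [? ?] [? ?] [-> ->].
  rewrite -[RHS](card_imset _ inj); apply: eq_card => -[u v].
  rewrite inE /=; apply/idP/imsetP => [H|[[x y]]]; first by exists (v, u); rewrite ?inE.
  by rewrite inE => H [-> ->].
have -> : #|arcs e| = 2 * #|[set p : S * S | b p.1 p.2]|.
  rewrite sube cardsU swap disjoint_setI0 ?cards0 ?subn0 ?mul2n ?addnn //.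
  by rewrite disjoint_subset; apply/subsetP=> p; rewrite !inE => /asym ->.
move=> H; apply: leq_trans (leq_addr 4 _) _; apply: H.
- by move=> u v; rewrite /e orbC.
- by move=> u; rewrite /e orbb; apply/negP=> /bh; rewrite hirr.
- by move=> u v /orP [/bi [fu _]|/bi [_ fu]]; rewrite inE fu.
Qed.

Lemma good_edges f :
  #|[set p : S * S | upward p.1 p.2 && good f p.1 p.2]| <= 3 * #|S|.
Proof.
rewrite -(leq_pmul2l (isT : 0 < 2)) mulnA.
have -> : #|[set p : S * S | upward p.1 p.2 && good f p.1 p.2]| =
  \sum_i #|[set p : S * S | [&& upward p.1 p.2, good f p.1 p.2 & f p.1 == i]]|.
  rewrite -sum1_card (partition_big (fun p => f p.1) predT) //=.
  apply: eq_bigr => i _; rewrite -sum1_card; apply: eq_bigl => p.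
  by rewrite !inE -andbA.
have -> : #|S| = \sum_i #|[set u | f u == i]|.
  rewrite -sum1_card (partition_big f predT) //=.
  apply: eq_bigr => i _; rewrite -sum1_card; apply: eq_bigl => p.
  by rewrite !inE.
rewrite !big_distrr; apply: leq_sum => i _; exact: good_edges_class.
Qed.

(** Once the common colour of [x] and [y] is chosen, a blocker has [N] colours left and any other
    vertex [N.+1]. The bound is multiplied out to avoid division. *)
Lemma card_good x y : h x y ->
  N ^ N * N.+1 ^ #|S| <= #|[set f | good f x y]| * N.+1 ^ N.+1.
Proof.
move=> hxy; have [cB xB yB] := blockers hxy.
have xy : x != y by apply/eqP=> E; rewrite E hirr in hxy.
(* The indicator that [z] may take colour [j] when [x] and [y] have colour [i]; the count becomes a
   sum of products over vertices. *)
pose w (i : 'I_N.+1) z (j : 'I_N.+1) : nat :=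
  if z \in [set x; y] then j == i else if z \in B x y then j != i else true.
have -> : #|[set f | good f x y]| = \sum_i \prod_z \sum_j w i z j.
  transitivity (\sum_i \sum_(f : {ffun S -> 'I_N.+1}) \prod_z w i z (f z)); last first.
    by apply: eq_bigr => i _; rewrite bigA_distr_bigA.
  rewrite exchange_big -sum1_card big_mkcond /=; apply: eq_bigr => f _.
  rewrite inE (bigD1 (f x)) //= [X in _ + X]big1 ?addn0.
    case: ifP => [/andP [/eqP fxy /forall_inP H]|].
      rewrite big1 // => z _; rewrite /w !inE; case: ifP => [/orP [] /eqP ->|_].
      - by rewrite eqxx.
      - by rewrite fxy eqxx.
      - by case: ifP => // /H ->.
    rewrite /good; case: eqP => [fxy|/eqP fxy] /=.
      move/negbT/forall_inPn => [z zB]; rewrite negbK => fz.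
      rewrite (bigD1 z) //= /w !inE fz zB.
      by case: eqP zB xB => [->|_ zB _]; [move=> -> | case: eqP zB yB => [-> ->|]].
    by move=> _; rewrite (bigD1 y) //= /w !inE eqxx orbT (eq_sym (f y)) (negbTE fxy).
  move=> i ix; rewrite (bigD1 x) //= /w !inE eqxx /=.
  by rewrite (eq_sym (f x)) (negbTE ix).
have wsum i z : \sum_j w i z j = if z \in [set x; y] then 1 else if z \in B x y then N else N.+1.
  rewrite /w; case: ifP => _; first by rewrite -big_mkcond big_pred1_eq.
  case: ifP => _; last by rewrite sum1_card card_ord.
  by rewrite -big_mkcond sum1_card /= cardC1 card_ord.
under eq_bigr => i _ do under eq_bigr => z _ do rewrite wsum.
rewrite sum_nat_const card_ord.
set P := \prod_z _.
have dis : [disjoint [set x; y] & B x y].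
  by rewrite disjoint_subset; apply/subsetP=> z; rewrite !inE => /orP [] /eqP ->.
have HP : P * N.+1 ^ (2 + #|B x y|) = N ^ #|B x y| * N.+1 ^ #|S|.
  have -> : 2 + #|B x y| = #|[set x; y] :|: B x y|.
    by rewrite cardsU disjoint_setI0 // cards0 subn0 cards2 xy.
  rewrite -(prod_nat_const (mem ([set x; y] :|: B x y))) -(prod_nat_const (mem (B x y))).
  rewrite -[X in _ = _ * X](prod_nat_const (mem S)).
  rewrite [X in P * X]big_mkcond [X in _ = X * _]big_mkcond /= -!big_split /=.
  apply: eq_bigr => z _; rewrite !inE.
  have := disjointFr dis (x := z); rewrite !inE.
  case: orP => _ /= zB; first by rewrite zB // mul1n mul1n.
  by case: ifP => _; rewrite ?muln1 ?mul1n.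
have -> : N.+1 * P * N.+1 ^ N.+1 = N.+1 ^ (N - #|B x y|) * (P * N.+1 ^ (2 + #|B x y|)).
  rewrite mulnCA -mulnA mulnCA; congr (_ * _); rewrite -expnS -expnD; congr (_ ^ _); lia.
rewrite HP mulnA leq_pmul2r ?expn_gt0 //.
have -> : N ^ N = N ^ (N - #|B x y|) * N ^ #|B x y| by rewrite -expnD subnK.
by rewrite leq_mul //; case: (N - _) => // k; rewrite leq_exp2r.
Qed.

(* A uniformly random colouring with N + 1 colours keeps a given edge with
   probability at least N ^ N / (N + 1) ^ (N + 1), which is at least
   1 / (3 (N + 1)). *)
Lemma upward_le : #|[set p : S * S | upward p.1 p.2]| <= 9 * N.+1 * #|S|.
Proof.
set m := #|_|; pose n := #|S|.
(* Double counting of the pairs of a colouring and an edge kept by it. *)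
have : m * (N ^ N * N.+1 ^ n) <= 3 * n * N.+1 ^ n * N.+1 ^ N.+1.
  apply: (@leq_trans (\sum_(p : S * S | upward p.1 p.2) #|[set f | good f p.1 p.2]| * N.+1 ^ N.+1)).
    rewrite /m -sum1_card big_distrl /= (eq_bigl (fun p : S * S => upward p.1 p.2)); last first.
      by move=> p; rewrite inE.
    by apply: leq_sum => p /andP [/card_good]; rewrite mul1n.
  rewrite -big_distrl /= leq_pmul2r ?expn_gt0 //.
  have -> : \sum_(p : S * S | upward p.1 p.2) #|[set f | good f p.1 p.2]|
     = \sum_f #|[set p : S * S | upward p.1 p.2 && good f p.1 p.2]|.
    transitivity (\sum_(p : S * S | upward p.1 p.2) \sum_f (good f p.1 p.2 : nat)).
      apply: eq_bigr => p _; rewrite -sum1_card big_mkcond /=; apply: eq_bigr => f _.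
      by rewrite inE; case: good.
    rewrite exchange_big /=; apply: eq_bigr => f _.
    rewrite -sum1_card [LHS]big_mkcond [RHS]big_mkcond /=; apply: eq_bigr => p _.
    by rewrite inE; case: upward; case: good.
  apply: (@leq_trans (\sum_(f : {ffun S -> 'I_N.+1}) 3 * n)).
    by apply: leq_sum => f _; apply: good_edges.
  by rewrite sum_nat_const card_ffun card_ord mulnC.
rewrite mulnA (mulnAC (3 * n)) leq_pmul2r ?expn_gt0 // => H.
(* This includes N = 0, where the power is 1. *)
have N0 : 0 < N ^ N by rewrite expn_gt0; case: (N).
rewrite -(leq_pmul2r N0); apply: leq_trans H _.
rewrite expnS mulnA; apply: leq_trans (leq_mul (leqnn _) (expn_succ_le N)) _.
by rewrite -/n; move: (N ^ N) => a; lia.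
Qed.
End Sampling.

(** * Branch sets and charged crossings *)

Section Walks.
Variables (T : finType) (pt : T -> point) (L : T -> T -> list point).

Fixpoint walk_along u (p : seq T) : list point :=
  if p is v :: p' then L u v ++ walk_along v p' else nil.

Lemma lwalk_along (g : rel T) u p :
  (forall v w, g v w -> lwalk (pt v) (L v w) /\ last (pt v) (L v w) = pt w) ->
  path g u p -> lwalk (pt u) (walk_along u p) /\ last (pt u) (walk_along u p) = pt (last u p).
Proof.
move=> wL; elim: p u => [|v p IH] u //= /andP [/wL [w l] /IH [w' l']].
by split; [apply: lwalk_cat; rewrite ?l | rewrite last_cat l].
Qed.

Lemma in_walk_along u p z : p != [::] -> In z (pt u :: walk_along u p) ->
  exists2 e, e \in zip (u :: p) p & In z (pt e.1 :: L e.1 e.2).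
Proof.
have tail v q : In z (walk_along v q) ->
    exists2 e, e \in zip (v :: q) q & In z (L e.1 e.2).
  elim: q v => [|w q IH] v //= /In_cat [zin|/IH [e ein zin]].
    by exists (v, w); rewrite // in_cons eqxx.
  by exists e; rewrite // in_cons ein orbT.
case: p => [//|v p] _ [<-|/tail [e ein zin]]; last by exists e => //; right.
by exists (u, v); [rewrite in_cons eqxx | left].
Qed.
End Walks.

Lemma zip_path (T : finType) (g : rel T) (u : T) p e :
  path g u p -> e \in zip (u :: p) p -> g e.1 e.2 /\ e.1 \in u :: p /\ e.2 \in u :: p.
Proof.
elim: p u => [|v p IH] u //= /andP [guv /IH H].
rewrite in_cons => /orP [/eqP ->|/H [? [? ?]]] /=; first by rewrite !inE !eqxx !orbT.
by rewrite !(in_cons u); split=> //; split; apply/orP; right.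
Qed.

Lemma set_of_Prop (S : finType) (P : S -> Prop) : exists A : {set S}, forall z, z \in A <-> P z.
Proof.
have [b Hb] : exists b : S -> bool, forall z, b z <-> P z.
  apply: (@fin_all_exists S (fun=> bool) (fun z c => c <-> P z)) => z.
  by case: (classic (P z)) => H; [exists true | exists false]; split.
by exists [set z | b z] => z; rewrite inE.
Qed.

Section Branch.
Variables (T : finType) (g : rel T) (S : finType) (h : rel S) (r : nat) (mu : S -> {set T}).
Hypotheses (gsym : symmetric g) (model : shallow_model h g r mu).

(** From the centre of [x] to an edge joining the two branch sets, across it, and on to the centre
    of [y]: r + 1 + r edges. *)
Lemma model_paths : exists ctr : S -> T, (forall v, ctr v \in mu v) /\
  forall x y, h x y -> exists p, [/\ path g (ctr x) p, last (ctr x) p = ctr y,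
    size p <= 2 * r + 1 & {subset ctr x :: p <= mu x :|: mu y}].
Proof.
have [_ _ rad adj] := model.
have [ctr Hc] := @fin_all_exists S (fun=> T)
  (fun v c => c \in mu v /\ forall x, x \in mu v -> reach_within g (mu v) r c x)
  (fun v => let: ex_intro2 c cA H := rad v in ex_intro _ c (conj cA H)).
exists ctr; split=> [v|x y /adj [a aA [b bB gab]]]; first by have [] := Hc v.
have [_ /(_ a aA) [p [sp pp lp /allP ap]]] := Hc x.
have [_ /(_ b bB) [q [sq pq lq /allP aq]]] := Hc y.
have lb : last b (rev (belast (ctr y) q)) = ctr y.
  have -> : last b (rev (belast (ctr y) q)) = last b (b :: rev (belast (ctr y) q)) by [].
  by rewrite -{2}lq -rev_rcons -lastI rev_cons last_rcons.
exists (p ++ b :: rev (belast (ctr y) q)); split.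
- rewrite cat_path pp lp /= gab /= -lq rev_path.
  by rewrite (eq_path (e' := g)) // => u v; rewrite gsym.
- by rewrite last_cat.
- by rewrite size_cat /= size_rev size_belast; lia.
move=> z; rewrite -cat_cons mem_cat in_setU => /orP [/ap ->//|].
rewrite in_cons mem_rev => /orP [/eqP ->|/mem_belast /aq ->]; by rewrite ?bB orbT.
Qed.
End Branch.

Lemma NoDup_map_uniq (S : eqType) (X : Type) (f : S -> X) s :
  uniq s -> {in s &, injective f} -> NoDup (map f s).
Proof.
have inmap y q : In y (map f q) -> exists2 x, x \in q & f x = y.
  elim: q => [//|a q IH] /= [<-|/IH [x xq <-]]; first by exists a; rewrite ?mem_head.
  by exists x; rewrite // in_cons xq orbT.
elim: s => [|a s IH] /=; first by move=> _ _; apply: NoDup_nil.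
move=> /andP [aNs us] inj; apply: NoDup_cons.
  move=> /inmap [x xs E]; move/negP: aNs; apply.
  by rewrite -(inj x a) // ?mem_head // in_cons xs orbT.
by apply: IH => // x y xs ys; apply: inj; rewrite in_cons ?xs ?ys orbT.
Qed.

Lemma same_edge_sym (T : finType) (e f : T * T) : same_edge e f -> same_edge f e.
Proof. by rewrite /same_edge => -[[-> ->]|[-> ->]]; [left | right]. Qed.

Lemma same_edge_trans (T : finType) (e f d : T * T) :
  same_edge e f -> same_edge f d -> same_edge e d.
Proof. by rewrite /same_edge => -[[-> ->]|[-> ->]] [[-> ->]|[-> ->]]; [left|right|right|left]. Qed.

Lemma same_edge_fst (T : finType) (e f : T * T) : same_edge e f -> e.1 \in [:: f.1; f.2].
Proof. by rewrite /same_edge !inE => -[[-> _]|[-> _]]; rewrite eqxx ?orbT. Qed.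

(** * Blockers from charged crossings *)

Section Gap.
Variables (T : finType) (g : rel T) (k : nat).
Variables (pos : T -> R * R) (curve : T -> T -> R -> R * R).
Hypothesis gap : k_gap_planar_drawing g k pos curve.

(* B e holds, for every crossing charged to e, the branch set containing an end of
   the other edge at that crossing. *)
Lemma gap_blockers (S : finType) (mu : S -> {set T}) :
  (forall v w, v != w -> [disjoint mu v & mu w]) ->
  exists B : T * T -> {set S},
    (forall e, g e.1 e.2 -> #|B e| <= k) /\
    (forall e f, g e.1 e.2 -> g f.1 f.2 ->
      e.1 \notin [:: f.1; f.2] -> e.2 \notin [:: f.1; f.2] ->
      [\/ forall s t, in01 s -> in01 t -> curve e.1 e.2 s <> curve f.1 f.2 t,
          exists2 u, u \in [:: f.1; f.2] & forall z, u \in mu z -> z \in B e |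
          exists2 u, u \in [:: e.1; e.2] & forall z, u \in mu z -> z \in B f]).
Proof.
move=> dmu; have [[injpos [draw triple]] [charge [chargeP charge_le]]] := gap.
(* At a crossing, an edge different from the charged one; elsewhere the value is arbitrary. *)
have [other otherP] : exists other : R * R -> T * T, forall p, crossing g curve p ->
    [/\ g (other p).1 (other p).2, ~ same_edge (charge p) (other p)
      & on_edge_interior curve (other p).1 (other p).2 p].
  have ex p : exists f : T * T, crossing g curve p ->
      [/\ g f.1 f.2, ~ same_edge (charge p) f & on_edge_interior curve f.1 f.2 p].
    case: (classic (crossing g curve p)) => [cp|n]; last by exists (charge p).
    have [v [w [v' [w' [g1 [g2 [n [i1 i2]]]]]]]] := cp.
    case: (classic (same_edge (charge p) (v, w))) => [E|nE]; last by exists (v, w).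
    exists (v', w') => _; split=> // E'; apply: n.
    exact: same_edge_trans (same_edge_sym E) E'.
  exists (fun p => sval (constructive_indefinite_description _ (ex p))) => p.
  exact: (svalP (constructive_indefinite_description _ (ex p))).
have [B HB] := @fin_all_exists _ _ _ (fun e : T * T => set_of_Prop (fun z : S =>
  exists p, [/\ crossing g curve p, same_edge (charge p) e & (other p).1 \in mu z])).
exists B; split.
  move=> e ge.
  (* Each blocker picks a crossing charged to [e]. Branch sets are disjoint, so different blockers
     pick different crossings, of which there are at most [k]. *)
  have [p Hp] : exists p : S -> R * R, forall z, z \in B e ->
      [/\ crossing g curve (p z), same_edge (charge (p z)) e & (other (p z)).1 \in mu z].
    apply: (@fin_all_exists S (fun=> (R * R)%type) (fun z q => z \in B e ->
      [/\ crossing g curve q, same_edge (charge q) e & (other q).1 \in mu z])) => z.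
    case: (boolP (z \in B e)) => [/HB [q Hq]|_]; last by exists (R0, R0).
    by exists q.
  have -> : #|B e| = length (map p (enum (B e))) by rewrite cardE -(size_map p).
  apply: (charge_le e.1 e.2 ge).
    apply: NoDup_map_uniq (enum_uniq _) _ => z z'; rewrite !mem_enum => /Hp [_ _ m1] /Hp [_ _ m2] E.
    apply/eqP; apply: contraT => /dmu /disjointFr /(_ m1).
    by rewrite E m2.
  move=> q; have : forall z, z \in enum (B e) -> z \in B e by move=> z; rewrite mem_enum.
  elim: (enum _) => [//|z s IH] sub /= [<-|]; last first.
    by apply: IH => x xs; apply: sub; rewrite in_cons xs orbT.
  by have [c1 c2 _] := Hp z (sub z (mem_head _ _)); split=> //; case: (e) c2.
have ends e s : g e.1 e.2 -> in01 s ->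
    (exists2 u, u \in [:: e.1; e.2] & curve e.1 e.2 s = pos u) \/
    on_edge_interior curve e.1 e.2 (curve e.1 e.2 s).
  move=> /draw [_ [c0 c1] _ _ _] [/Rle_lt_or_eq_dec [s0|<-] s1]; last first.
    by left; exists e.1; rewrite ?inE ?eqxx.
  case: (Rle_lt_or_eq_dec _ _ s1) => [{}s1|->]; first by right; exists s.
  by left; exists e.2; rewrite ?inE ?eqxx ?orbT.
have avoid e p u : g e.1 e.2 -> on_edge_interior curve e.1 e.2 p -> p <> pos u.
  by move=> /draw [_ _ _ _ H] [t [t01 <-]]; apply: H.
have charged e f p : g e.1 e.2 -> g f.1 f.2 -> ~ same_edge e f ->
    on_edge_interior curve e.1 e.2 p -> on_edge_interior curve f.1 f.2 p ->
    same_edge (charge p) e -> exists2 u, u \in [:: f.1; f.2] & forall z, u \in mu z -> z \in B e.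
  case: e f => [v w] [v' w'] /= ge gf nef ie jf ce.
  have cp : crossing g curve p by exists v, w, v', w'.
  have [go no io] := otherP p cp; exists (other p).1; last first.
    by move=> z zu; apply/HB; exists p.
  (* No three edges cross at one point, so [other p] is the edge [f], up to orientation. *)
  case: (triple p v w v' w' _ _ ge gf go ie jf io) => [//|[E|E]].
    by case: no; apply: same_edge_trans ce _; move: E; case: (other p).
  by have := same_edge_fst (same_edge_sym E).
move=> e f ge gf n1 n2.
have nef : ~ same_edge e f by move=> /same_edge_fst; rewrite (negbTE n1).
case: (classic (forall s t, in01 s -> in01 t -> curve e.1 e.2 s <> curve f.1 f.2 t)).
  by move=> H; apply: Or31.
move=> /not_all_ex_not [s /not_all_ex_not [t nst]].
have [sI [tI E]] : in01 s /\ in01 t /\ curve e.1 e.2 s = curve f.1 f.2 t.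
  by split; [|split]; apply: NNPP => n; apply: nst => // ? ? ?; apply: n.
(* A common point is no vertex: the edges share no end, and the interior of a curve avoids all
   vertices. So it is a crossing, charged to [e] or to [f]. *)
case: (ends e s ge sI) (ends f t gf tI) => [[u ue Eu]|ie] [[v vf Ev]|jf].
- have uv : u = v by apply: injpos; rewrite -Eu E.
  by move: ue vf n1 n2; rewrite -uv !in_cons !in_nil => /or3P [] // /eqP -> ->.
- by have := avoid f _ u gf jf; rewrite -E Eu.
- by have := avoid e _ v ge ie; rewrite E Ev.
set p := curve e.1 e.2 s in ie; rewrite -E -/p in jf.
have cp : crossing g curve p.
  by exists e.1, e.2, f.1, f.2; split=> //; split=> //; case: (e) (f) nef => ? ? [].
have [gc ic] := chargeP p cp.
have := triple p _ _ _ _ _ _ gc ge gf ic ie jf.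
have eta (d : T * T) : (d.1, d.2) = d by case: d.
rewrite !eta => -[ce|[cf|//]].
  by apply: Or32; apply: charged ce.
apply: Or33; apply: charged cf => //; by move=> /same_edge_sym.
Qed.

(** The colouring bound with N = k(2r + 1): a path has at most 2r + 1 edges, each with at most k
    blockers. *)
Lemma upward_minor_le (r : nat) (S : finType) (h : rel S) (mu : S -> {set T}) :
  symmetric g -> irreflexive h -> shallow_model h g r mu ->
  #|[set p : S * S | upward h p.1 p.2]| <= 9 * (k * (2 * r + 1)).+1 * #|S|.
Proof.
move=> gsym hirr model.
have [_ dmu _ _] := model.
have [B [cB HB]] := gap_blockers dmu.
have [c [L [wL dL]]] : exists (c : T -> point) (L : T -> T -> list point),
    (forall v w, g v w -> lwalk (c v) (L v w) /\ last (c v) (L v w) = c w) /\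
    (forall v w v' w', g v w -> g v' w' ->
      (forall s t, in01 s -> in01 t -> curve v w s <> curve v' w' t) ->
      ldisjoint (c v :: L v w) (c v' :: L v' w')).
  apply: (@discretise T g pos) => v w gvw.
  by have [[_ [/(_ v w gvw) [? [? ?] _ _ _] _]] _] := gap.
have [ctr [ctrP paths]] := model_paths gsym model.
have [P HP] := @fin_all_exists (S * S)%type (fun=> seq T) (fun e p => h e.1 e.2 ->
  [/\ path g (ctr e.1) p, last (ctr e.1) p = ctr e.2,
    size p <= 2 * r + 1 & {subset ctr e.1 :: p <= mu e.1 :|: mu e.2}])
  (fun e => match boolP (h e.1 e.2) with
    | AltTrue H => let: ex_intro p Hp := paths _ _ H in ex_intro _ p (fun _ => Hp)
    | AltFalse H => ex_intro _ [::] (fun H' => False_ind _ (negP H H')) end).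
pose edges x y := zip (ctr x :: P (x, y)) (P (x, y)).
(* Discarding [x] and [y] is harmless, since only edges of [h] with four distinct ends are
   compared. *)
pose B' x y := (\bigcup_(e <- edges x y) B e) :\: [set x; y].
have owner z z' u : u \in mu z -> u \in mu z' -> z = z'.
  move=> m1 m2; apply/eqP; apply: contraT => /dmu /disjointFr /(_ m1).
  by rewrite m2.
have edgeP x y e : h x y -> e \in edges x y ->
    [/\ g e.1 e.2, e.1 \in mu x :|: mu y & e.2 \in mu x :|: mu y].
  move=> /(HP (x, y)) [pp _ _ sub] /(zip_path pp) [ge [m1 m2]].
  by split=> //; apply: sub.
have nonempty x y : h x y -> P (x, y) != [::].
  move=> hxy; apply/eqP=> E; have [_ + _ _] := HP (x, y) hxy; rewrite E /= => El.
  by have := ctrP y; rewrite -El => /(owner _ _ _ (ctrP x)) xy; rewrite xy hirr in hxy.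
apply: (@upward_le S h _ (fun x => c (ctr x)) (fun x y => walk_along L (ctr x) (P (x, y))) B' hirr).
- move=> x y hxy; have [pp lp _ _] := HP (x, y) hxy.
  by have := lwalk_along wL pp; rewrite lp.
- move=> x y hxy; have [pp _ sp _] := HP (x, y) hxy.
  split; try by rewrite !inE eqxx ?orbT.
  apply: leq_trans (subset_leq_card (subsetDl _ _)) _.
  have : forall e, e \in edges x y -> #|B e| <= k by move=> e /(edgeP _ _ _ hxy) [/cB].
  have : size (edges x y) <= 2 * r + 1 by rewrite size_zip /=; lia.
  move: (2 * r + 1) => N.
  suff le (s : seq (T * T)) : (forall e, e \in s -> #|B e| <= k) ->
      #|\bigcup_(e <- s) B e| <= k * size s.
    by move=> sz /le H; apply: leq_trans H _; rewrite leq_mul2l sz orbT.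
  elim: s => [|e s IH] H; first by rewrite big_nil cards0.
  rewrite big_cons /= mulnS; apply: leq_trans (leq_card_setU _ _) _.
  by rewrite leq_add ?H ?mem_head // IH // => f fs; rewrite H // in_cons fs orbT.
move=> x y u v hxy huv xu xv yu yv.
case: (boolP [|| u \in B' x y, v \in B' x y, x \in B' u v | y \in B' u v]); first by right.
rewrite !negb_or => /and4P [b1 b2 b3 b4]; left=> z zxy zuv.
have [e ein ze] := in_walk_along (nonempty _ _ hxy) zxy.
have [f fin zf] := in_walk_along (nonempty _ _ huv) zuv.
have [ge e1 e2] := edgeP _ _ _ hxy ein; have [gf f1 f2] := edgeP _ _ _ huv fin.
(* Branch sets of distinct vertices are disjoint, so the edges of the two paths share no end. *)
have sep a b : a \in mu x :|: mu y -> b \in mu u :|: mu v -> a != b.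
  move=> H1 H2; apply/eqP=> ab; move: H1 H2; rewrite -ab !in_setU.
  by move=> /orP [] m1 /orP [] m2; have E := owner _ _ _ m1 m2; move: xu xv yu yv; rewrite E ?eqxx.
have inB a b a' b' e' d : e' \in edges a b -> d \in mu a' :|: mu b' ->
    a != a' -> a != b' -> b != a' -> b != b' ->
    (forall z, d \in mu z -> z \in B e') -> (a' \in B' a b) || (b' \in B' a b).
  move=> e'in; rewrite in_setU => dm n1 n2 n3 n4 H.
  have sub : B e' \subset \bigcup_(e <- edges a b) B e by rewrite bigcup_seq; apply: bigcup_sup.
  rewrite !inE !negb_or (eq_sym a') n1 (eq_sym a') n3 (eq_sym b') n2 (eq_sym b') n4 /=.
  by case/orP: dm => /H /(subsetP sub) ->; rewrite ?orbT.
have [||D|[d dmf dB]|[d dme dB]] := HB e f ge gf.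
- by rewrite !inE negb_or !sep.
- by rewrite !inE negb_or !sep.
- exact: (dL _ _ _ _ ge gf D z ze zf).
- have dm : d \in mu u :|: mu v by move: dmf; rewrite !inE => /orP [] /eqP ->; rewrite -in_setU.
  by have := inB x y u v e d ein dm xu xv yu yv dB; rewrite (negbTE b1) (negbTE b2).
- have dm : d \in mu x :|: mu y by move: dme; rewrite !inE => /orP [] /eqP ->; rewrite -in_setU.
  rewrite eq_sym in xu; rewrite eq_sym in xv; rewrite eq_sym in yu; rewrite eq_sym in yv.
  by have := inB u v x y f d fin dm xu yu xv yv dB; rewrite (negbTE b3) (negbTE b4).
Qed.
End Gap.

(** * From edge counts to density *)

Lemma edge_set_upward (S : finType) (h : rel S) : symmetric h -> irreflexive h ->
  #|edge_set h| <= #|[set p : S * S | upward h p.1 p.2]|.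
Proof.
move=> hsym hirr.
apply: leq_trans (leq_imset_card (fun p : S * S => [set p.1; p.2]) _).
apply: subset_leq_card; apply/subsetP=> _ /imsetP [[x y] + ->]; rewrite inE /= => hxy.
case: (ltngtP (enum_rank x) (enum_rank y)) => [lt|lt|/val_inj/enum_rank_inj E].
- by apply/imsetP; exists (x, y); rewrite // inE /upward hxy lt.
- by apply/imsetP; exists (y, x); rewrite ?inE /upward /= ?(hsym y) ?hxy ?lt //= setUC.
- by rewrite E hirr in hxy.
Qed.

(* For every r, every r-shallow minor H of G has density at most
   18(k+1)(r+1); i.e. nabla_r(G) <= 18(k+1)(r+1). *)
Theorem theorem1 (k : nat) (T : finType) (g : rel T) :
  simple_graph g -> k_gap_planar g k ->
  forall (r : nat) (S : finType) (h : rel S),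
    simple_graph h -> shallow_minor h g r ->
    (density h <= (18 * (k + 1) * (r + 1))%:R :> rat)%R.
Proof.
move=> [gsym _] [pos [curve gap]] r S h [hsym hirr] [mu model].
rewrite /density; case: eqP => [_|/eqP S0]; first exact: ler0n.
rewrite ler_pdivrMr ?ltr0n ?lt0n // -natrM ler_nat.
apply: leq_trans (edge_set_upward hsym hirr) _.
apply: leq_trans (upward_minor_le gap gsym hirr model) _.
(* The arithmetic is 9(k(2r + 1) + 1) <= 18(k + 1)(r + 1). *)
by rewrite leq_mul2r; apply/orP; right; nia.
Qed.
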